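(* The Bergman projection $P$ on the Hartogs triangle $\mathbb{H}$ is not of weak-type $(4/3,4/3)$: there is no constant $C>0$ such that for all $f\in L^{4/3}(\mathbb{H})$ for which the integral defining $P(f)$ converges absolutely, and all $\lambda>0$, $$\left|\{z\in\mathbb{H} : |P(f)(z)|>\lambda\}\right| \le \frac{C\,\|f\|^{4/3}_{L^{4/3}(\mathbb{H})}}{\lambda^{4/3}}.$$
   Context: The Hartogs triangle is $\mathbb{H}=\{(z_1,z_2)\in\mathbb{C}^2:|z_1|<|z_2|<1\}$; $dV$ is Lebesgue measure and $|U|$ the Lebesgue measure of $U$. The Bergman projection on $\mathbb{H}$ (orthogonal projection of $L^2(\mathbb{H})$ onto holomorphic $L^2$ functions) is $P(f)(z)=\int_{\mathbb{H}}K_{\mathbb{H}}(z;\bar w)f(w)\,dV(w)$ with $$K_{\mathbb{H}}(z_1,z_2;\bar w_1,\bar w_2)=\frac{1}{\pi^2 z_2\bar w_2\left(1-\frac{z_1\bar w_1}{z_2\bar w_2}\right)^2(1-z_2\bar w_2)^2}.$$ *)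

(* Defs.v *)
(* complex numbers from mathcomp-real-closed. *)
From HB Require Import structures.
From mathcomp Require Import all_boot all_order all_algebra.
From mathcomp Require Import all_classical all_reals all_analysis.
From mathcomp Require Import complex.
Set Implicit Arguments. Unset Strict Implicit. Unset Printing Implicit Defensive.
Import Order.TTheory GRing.Theory Num.Theory.
Local Open Scope ring_scope.
Local Open Scope classical_set_scope.

(* Points of C^2 = R^4, encoded as (((Re z1, Im z1), Re z2), Im z2),
   each real coordinate carrying Lebesgue's (Borel) measurable structure. *)
Definition C2 (R : realType) :=
  (((measurableTypeR R * measurableTypeR R) * measurableTypeR R)
     * measurableTypeR R)%type.

Section Hartogs.
Variable R : realType.
Local Open Scope complex_scope.

Definition cabs (x : R[i]) : R := ComplexField.Normc.normc x.

Definition z1c (p : C2 R) : R[i] := (p.1.1.1 +i* p.1.1.2).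
Definition z2c (p : C2 R) : R[i] := (p.1.2 +i* p.2).

(* Lebesgue measure on C^2 ~ R^4 (product of four copies of Lebesgue measure on R). *)
Definition lebR : {sigma_finite_measure set (measurableTypeR R) -> \bar R} :=
  @lebesgue_measure R.
Definition leb4 : {measure set (C2 R) -> \bar R} :=
  (((lebR \x lebR) \x lebR) \x lebR)%E.

(* The Hartogs triangle { |z1| < |z2| < 1 }. *)
Definition Hartogs : set (C2 R) :=
  [set p | cabs (z1c p) < cabs (z2c p) < 1].

(* The Bergman kernel of the Hartogs triangle, K(z; conj w). *)
Definition KH (z w : C2 R) : R[i] :=
  ((pi : R)%:C ^+ 2 * z2c z * (z2c w)^*
     * (1 - z1c z * (z1c w)^* / (z2c z * (z2c w)^*)) ^+ 2
     * (1 - z2c z * (z2c w)^*) ^+ 2)^-1.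

(* The Bergman projection P(f)(z) = \int_H K(z; conj w) f(w) dV(w),
   the complex integral being split into real and imaginary parts. *)
Definition bergmanP (f : C2 R -> R[i]) (z : C2 R) : R[i] :=
  (Rintegral leb4 Hartogs (fun w => complex.Re (KH z w * f w))) +i*
  (Rintegral leb4 Hartogs (fun w => complex.Im (KH z w * f w))).

End Hartogs.

(* Main.v *)
(* The kernel K(z; conj w) equals 1 / (pi^2 z2 conj(w2)) up to factors that are
   close to 1 when z lies in a small box U on which |z1| << |z2| << 1.  If moreover
   z2 and w2 are nearly positive real, then Re K(z; conj w) >= c / t for w in a box
   B(t) near (0, 5t/8), whose volume is proportional to t^4.  Take
   f = sum_(k < n) t_k^-3 1_B(t_k) with t_k = 2^-k: the boxes are disjoint, so
   ||f||^(4/3) is proportional to n, while |P f| >= c' n on U.  The weak-type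
   inequality at a level lambda proportional to n then reads
   |U| <= C' n / n^(4/3), which fails for large n. *)
Require Import Defs.
From HB Require Import structures.
From mathcomp Require Import all_boot all_order all_algebra.
From mathcomp Require Import all_classical all_reals all_analysis.
From mathcomp Require Import measurable_realfun.
From mathcomp Require Import complex.
From mathcomp Require Import ring lra.
Import Order.TTheory GRing.Theory Num.Theory.
Local Open Scope ring_scope.
Local Open Scope classical_set_scope.

(** * Measurability of complex-valued functions and of integrals depending on a parameter *)

Section ComplexMeasurability.
Context {d : measure_display} {T : measurableType d} {R : realType}.
Implicit Types f g : T -> R[i].

(** Componentwise, to match [bergmanP] and the hypotheses on f in the theorem, which treat real and
    imaginary parts separately. *)
Definition cmeasurable f :=
  measurable_fun setT (fun x => complex.Re (f x)) /\
  measurable_fun setT (fun x => complex.Im (f x)).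

Lemma cmeasurable_cst (c : R[i]) : cmeasurable (fun=> c).
Proof. by split; exact: measurable_cst. Qed.

Lemma cmeasurableB f g :
  cmeasurable f -> cmeasurable g -> cmeasurable (fun x => f x - g x).
Proof.
move=> [fr fi] [gr gi]; split.
  rewrite (_ : (fun _ => _) = (fun x => complex.Re (f x)) \- (fun x => complex.Re (g x))).
    exact: measurable_funB.
  by apply/funext => x /=; case: (f x) (g x) => a b [].
rewrite (_ : (fun _ => _) = (fun x => complex.Im (f x)) \- (fun x => complex.Im (g x))).
  exact: measurable_funB.
by apply/funext => x /=; case: (f x) (g x) => a b [].
Qed.

Lemma cmeasurableM f g :
  cmeasurable f -> cmeasurable g -> cmeasurable (fun x => f x * g x).
Proof.
move=> [fr fi] [gr gi]; split.
  rewrite (_ : (fun _ => _) =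
      ((fun x => complex.Re (f x)) \* (fun x => complex.Re (g x))) \-
      ((fun x => complex.Im (f x)) \* (fun x => complex.Im (g x)))).
    by apply: measurable_funB; exact: measurable_funM.
  by apply/funext => x /=; case: (f x) (g x) => a b [].
rewrite (_ : (fun _ => _) =
    ((fun x => complex.Re (f x)) \* (fun x => complex.Im (g x))) \+
    ((fun x => complex.Im (f x)) \* (fun x => complex.Re (g x)))).
  by apply: measurable_funD; exact: measurable_funM.
by apply/funext => x /=; case: (f x) (g x) => a b [].
Qed.

Lemma cmeasurableX f n : cmeasurable f -> cmeasurable (fun x => f x ^+ n).
Proof.
move=> mf; elim: n => [|n ih]; first exact: cmeasurable_cst.
by under eq_fun do rewrite exprS; exact: cmeasurableM.
Qed.

Lemma cmeasurable_conj f : cmeasurable f -> cmeasurable (fun x => (f x)^*%C).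
Proof.
move=> [fr fi]; split.
  by rewrite (_ : (fun _ => _) = fun x => complex.Re (f x)) //;
    apply/funext => x; case: (f x).
rewrite (_ : (fun _ => _) = \- (fun x => complex.Im (f x))).
  exact: measurableT_comp.
by apply/funext => x /=; case: (f x).
Qed.

Lemma cmeasurableV f : cmeasurable f -> cmeasurable (fun x => (f x)^-1).
Proof.
move=> [fr fi].
(* The inverse is conj(f) / |f|^2. Writing the reciprocal as a real power makes it measurable; at
   zeros of f the power and the inverse both take the value 0. *)
pose n x := (complex.Re (f x) ^+ 2 + complex.Im (f x) ^+ 2) `^ (-1).
have mn : measurable_fun setT n.
  apply: (measurableT_comp (measurable_powR (-1))).
  by apply: measurable_funD; exact: measurable_funX.
have nE x : n x = (complex.Re (f x) ^+ 2 + complex.Im (f x) ^+ 2)^-1.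
  by rewrite /n powR_inv1// addr_ge0 ?sqr_ge0.
split.
  rewrite (_ : (fun _ => _) = (fun x => complex.Re (f x)) \* n).
    exact: measurable_funM.
  by apply/funext => x; rewrite /= nE; case: (f x).
rewrite (_ : (fun _ => _) = \- ((fun x => complex.Im (f x)) \* n)).
  by apply: measurableT_comp => //; exact: measurable_funM.
by apply/funext => x; rewrite /= nE; case: (f x).
Qed.

Lemma measurable_cabs f : cmeasurable f -> measurable_fun setT (fun x => cabs (f x)).
Proof.
move=> [fr fi].
rewrite (_ : (fun _ => _) = fun x =>
   (complex.Re (f x) ^+ 2 + complex.Im (f x) ^+ 2) `^ 2^-1).
  apply: (measurableT_comp (measurable_powR 2^-1)).
  by apply: measurable_funD; exact: measurable_funX.
apply/funext => x; rewrite powR12_sqrt ?addr_ge0 ?sqr_ge0//.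
by rewrite /cabs; case: (f x).
Qed.

End ComplexMeasurability.

Lemma cmeasurable_comp {d1 d2 : measure_display} {T1 : measurableType d1}
    {T2 : measurableType d2} {R : realType} (f : T2 -> R[i]) (h : T1 -> T2) :
  measurable_fun setT h -> cmeasurable f -> cmeasurable (f \o h).
Proof.
move=> mh [fr fi].
by split; [exact: (measurableT_comp fr mh)|exact: (measurableT_comp fi mh)].
Qed.

(** Tonelli applies to the positive and the negative part of [g] times the indicator of [D]; the
    difference of the two integrals is measurable, and so is its [fine]. *)
Lemma measurable_Rintegral_param {d1 d2 : measure_display}
    {T1 : measurableType d1} {T2 : measurableType d2} {R : realType}
    (m : {sigma_finite_measure set T2 -> \bar R}) (D : set T2)
    (g : T1 * T2 -> R) :
  measurable D -> measurable_fun setT g ->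
  measurable_fun setT (fun x => Rintegral m D (fun y => g (x, y))).
Proof.
move=> mD mg; pose h (p : T1 * T2) := ((g p * \1_D p.2)%:E : \bar R).
have mh : measurable_fun setT h.
  apply/measurable_EFinP; apply: measurable_funM => //.
  have mi : measurable_fun setT (\1_D : T2 -> R) by exact: measurable_indic.
  exact: (measurableT_comp mi measurable_snd).
have -> : (fun x => Rintegral m D (fun y => g (x, y))) =
    fine \o ((fun x => (\int[m]_y (h^\+%E (x, y)))%E) \-
             (fun x => (\int[m]_y (h^\-%E (x, y)))%E))%E.
  apply/funext => x; rewrite /Rintegral /= integral_mkcond integralE.
  congr (fine (_ - _)%E); apply: eq_integral => y _;
    by rewrite unlock /h /patch indicE /=; case: ifP => _;
      rewrite ?mulr1 ?mulr0.
apply: measurableT_comp => //; apply: emeasurable_funB.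
  apply: measurable_fun_fubini_tonelli_F => //; exact: measurable_funepos.
apply: measurable_fun_fubini_tonelli_F => //; exact: measurable_funeneg.
Qed.

(** * Sigma-finiteness of iterated product measures *)

Section ProductMeasure.
Context {d1 d2 : measure_display} {T1 : measurableType d1}
  {T2 : measurableType d2} {R : realType}.
Variables (m1 : {sigma_finite_measure set T1 -> \bar R})
  (m2 : {sigma_finite_measure set T2 -> \bar R}).

(* A copy of [m1 \x m2], on which no other canonical instance shadows
   sigma-finiteness. *)
Definition prod_measure : set (T1 * T2) -> \bar R := (m1 \x m2)%E.

HB.instance Definition _ := Measure.on prod_measure.

Let prod_measure_sigma_finite : sigma_finite setT prod_measure.
Proof.
exact: isSigmaFinite.sigma_finiteT
  (lebesgue_integral_fubini.measure_function_Measure_isSigmaFinite__to__measure_function_isSigmaFinite m1 m2).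
Qed.

HB.instance Definition _ :=
  Measure_isSigmaFinite.Build _ _ _ prod_measure prod_measure_sigma_finite.

End ProductMeasure.

(** * Measurability of the Hartogs triangle, the kernel and the projection *)

Section Measurability.
Variable R : realType.

Lemma cmeasurable_z1c : cmeasurable (@z1c R).
Proof.
split => /=.
  exact: (measurableT_comp measurable_fst (measurableT_comp measurable_fst measurable_fst)).
exact: (measurableT_comp measurable_snd (measurableT_comp measurable_fst measurable_fst)).
Qed.

Lemma cmeasurable_z2c : cmeasurable (@z2c R).
Proof.
split => /=; first exact: (measurableT_comp measurable_snd measurable_fst).
exact: measurable_snd.
Qed.

Lemma measurable_Hartogs : measurable (@Hartogs R).
Proof.
have m1 := measurable_cabs _ cmeasurable_z1c.
have m2 := measurable_cabs _ cmeasurable_z2c.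
have -> : @Hartogs R = (fun p => cabs (z1c p) < cabs (z2c p)) @^-1` [set true] `&`
              (fun p => cabs (z2c p) < 1) @^-1` [set true].
  apply/seteqP; split => p; rewrite /Hartogs /=; first by move=> /andP[-> ->].
  by move=> [-> ->].
apply: measurableI; rewrite -[X in measurable X]setTI.
  exact: (measurable_fun_ltr m1 m2).
exact: (measurable_fun_ltr m2 (measurable_cst _)).
Qed.

Lemma cmeasurable_KH : cmeasurable (fun p : C2 R * C2 R => KH p.1 p.2).
Proof.
have m1 : measurable_fun setT (fst : C2 R * C2 R -> C2 R) := measurable_fst.
have m2 : measurable_fun setT (snd : C2 R * C2 R -> C2 R) := measurable_snd.
have z1 := cmeasurable_comp _ _ m1 cmeasurable_z1c.
have z2 := cmeasurable_comp _ _ m1 cmeasurable_z2c.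
have w1 := cmeasurable_conj _ (cmeasurable_comp _ _ m2 cmeasurable_z1c).
have w2 := cmeasurable_conj _ (cmeasurable_comp _ _ m2 cmeasurable_z2c).
have c1 := @cmeasurable_cst _ (C2 R * C2 R)%type R 1.
have cpi := @cmeasurable_cst _ (C2 R * C2 R)%type R ((pi : R)%:C%C ^+ 2).
have z2w2 := cmeasurableM _ _ z2 w2.
have q := cmeasurableM _ _ (cmeasurableM _ _ z1 w1) (cmeasurableV _ z2w2).
exact: (cmeasurableV _ (cmeasurableM _ _ (cmeasurableM _ _
  (cmeasurableM _ _ (cmeasurableM _ _ cpi z2) w2)
  (cmeasurableX _ 2 (cmeasurableB _ _ c1 q)))
  (cmeasurableX _ 2 (cmeasurableB _ _ c1 z2w2)))).
Qed.

(** The measure [leb4] rebuilt from [prod_measure], so that each stage carries the sigma-finiteness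
    that Tonelli requires. *)
Definition leb4_sigma_finite : {sigma_finite_measure set (C2 R) -> \bar R} :=
  prod_measure (prod_measure (prod_measure (@lebR R) (@lebR R)) (@lebR R)) (@lebR R).

Lemma leb4_sigma_finiteE :
  @leb4 R = leb4_sigma_finite :> {measure set (C2 R) -> \bar R}.
Proof. by []. Qed.

(** Makes the superlevel sets of |P f| measurable, so that the measure of a subset can be compared
    with theirs. *)
Lemma measurable_bergmanP (f : C2 R -> R[i]) :
  cmeasurable f -> measurable_fun setT (fun z => cabs (bergmanP f z)).
Proof.
move=> mf; apply: measurable_cabs.
have [mr mi] : cmeasurable (fun p : C2 R * C2 R => KH p.1 p.2 * f p.2).
  by apply: cmeasurableM; [exact: cmeasurable_KH|exact: cmeasurable_comp].
rewrite /bergmanP leb4_sigma_finiteE; split => /=.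
  exact: (measurable_Rintegral_param leb4_sigma_finite _ _ measurable_Hartogs mr).
exact: (measurable_Rintegral_param leb4_sigma_finite _ _ measurable_Hartogs mi).
Qed.

End Measurability.

(** * The complex modulus, and products and inverses of numbers near 1 *)

Section Cabs.
Variable R : realType.
Implicit Types x y : R[i].

Lemma cabs_ge0 x : 0 <= cabs x.
Proof. by case: x => a b; exact: sqrtr_ge0. Qed.

Lemma cabsM x y : cabs (x * y) = cabs x * cabs y.
Proof. exact: ComplexField.Normc.normcM. Qed.

Lemma cabsV x : cabs x^-1 = (cabs x)^-1.
Proof. exact: ComplexField.Normc.normcV. Qed.

Lemma cabs1 : cabs (1 : R[i]) = 1.
Proof. exact: ComplexField.Normc.normc1. Qed.

Lemma cabsX x n : cabs (x ^+ n) = cabs x ^+ n.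
Proof. by elim: n => [|n ih]; rewrite ?expr0 ?cabs1// !exprS cabsM ih. Qed.

Lemma cabs_conj x : cabs x^*%C = cabs x.
Proof. by case: x => a b; rewrite /cabs /= sqrrN. Qed.

Lemma cabs_real (a : R) : cabs (a%:C)%C = `|a|.
Proof. by rewrite /cabs /= expr0n addr0 sqrtr_sqr. Qed.

Lemma ler_cabsD x y : cabs (x + y) <= cabs x + cabs y.
Proof. exact: le_normcD. Qed.

Lemma ler_cabsB x y : cabs x - cabs y <= cabs (x - y).
Proof. by rewrite lerBlDr -{1}(subrK y x) ler_cabsD. Qed.

Lemma cabs_sqr x : cabs x ^+ 2 = complex.Re x ^+ 2 + complex.Im x ^+ 2.
Proof. by case: x => a b; rewrite sqr_sqrtr// addr_ge0 ?sqr_ge0. Qed.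

Lemma ler_Re_cabs x : `|complex.Re x| <= cabs x.
Proof.
by rewrite -(ler_pXn2r (n := 2)) ?nnegrE ?cabs_ge0// cabs_sqr real_normK ?num_real// lerDl sqr_ge0.
Qed.

Lemma cabs_le_ReIm x : cabs x <= `|complex.Re x| + `|complex.Im x|.
Proof.
rewrite -(ler_pXn2r (n := 2)) ?nnegrE ?cabs_ge0 ?addr_ge0// cabs_sqr.
have := normr_ge0 (complex.Re x); have := normr_ge0 (complex.Im x).
rewrite -(real_normK (num_real (complex.Re x))) -(real_normK (num_real (complex.Im x))); nra.
Qed.

(** The error is ee' + e + e'; written as (1 + e)(1 + e') - 1, it compounds when the lemma is
    iterated. *)
Lemma near1M (e e' : R) x y : cabs (x - 1) <= e -> cabs (y - 1) <= e' ->
  cabs (x * y - 1) <= (1 + e) * (1 + e') - 1.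
Proof.
move=> xe ye.
have -> : x * y - 1 = (x - 1) * (y - 1) + ((x - 1) + (y - 1)) by ring.
apply: le_trans (ler_cabsD _ _) _; rewrite cabsM.
have := ler_cabsD (x - 1) (y - 1); have := cabs_ge0 (x - 1); have := cabs_ge0 (y - 1).
nra.
Qed.

Lemma Re_inv x : complex.Re x^-1 = complex.Re x / cabs x ^+ 2.
Proof. by rewrite cabs_sqr; case: x. Qed.

(** Re(1/x) = Re x / |x|^2, with Re x >= 13/20 and |x| <= 27/20. *)
Lemma near1_Re_inv x : cabs (x - 1) <= 7/20 -> 1/3 <= complex.Re x^-1.
Proof.
move=> xe; rewrite Re_inv.
have re : 13/20 <= complex.Re x.
  have := le_trans (ler_Re_cabs _) xe.
  by case: x {xe} => a b /=; rewrite ler_norml => /andP[]; lra.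
have ax : cabs x <= 27/20.
  have := ler_cabsD (x - 1) 1; rewrite subrK cabs1; lra.
have a0 : 13/20 <= cabs x by apply: le_trans re (le_trans (ler_norm _) (ler_Re_cabs _)).
rewrite ler_pdivlMr ?exprn_gt0//; last lra.
nra.
Qed.

End Cabs.

(** * The boxes B(t) and their volume *)

Lemma product_measure1_fin {d1 d2 : measure_display} {T1 : measurableType d1}
    {T2 : measurableType d2} {R : realType} (m1 : {measure set T1 -> \bar R})
    (m2 : {sigma_finite_measure set T2 -> \bar R}) (A : set T1) (B : set T2)
    (a b : R) :
  measurable A -> measurable B -> m1 A = a%:E -> m2 B = b%:E ->
  (m1 \x m2)%E (A `*` B) = (a * b)%:E.
Proof. by move=> mA mB Aa Bb; rewrite product_measure1E// Aa Bb. Qed.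

Section Box.
Variable R : realType.
Implicit Types (t : R) (z w : C2 R).

(** The sides t/80 give |z1| < t/40 < |z2|/20 and keep z2 nearly real. The upper end 3t/4 leaves
    |z2| < t, and it makes the boxes of sizes t and t/2 disjoint, since 3t/8 < t/2. *)
Definition box t : set (C2 R) :=
  ((`]0, t / 80[ `*` `]0, t / 80[) `*` `]t / 2, t * (3/4)[) `*` `]0, t / 80[.

Lemma measurable_box t : measurable (box t).
Proof. by apply: measurableX => //; apply: measurableX => //; exact: measurableX. Qed.

Lemma boxP t w : box t w ->
  [/\ [/\ 0 < w.1.1.1 & w.1.1.1 < t / 80], [/\ 0 < w.1.1.2 & w.1.1.2 < t / 80],
      [/\ t / 2 < w.1.2 & w.1.2 < t * (3/4)] & [/\ 0 < w.2 & w.2 < t / 80]].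
Proof.
by case; case; case; rewrite /= !in_itv /= => /andP[? ?] /andP[? ?] /andP[? ?] /andP[? ?].
Qed.

Lemma box_cabs t w : 0 < t -> box t w ->
  [/\ cabs (z1c w) <= cabs (z2c w) / 20, t / 2 < cabs (z2c w) & cabs (z2c w) < t].
Proof.
move=> t0 /boxP[[a0 a1] [b0 b1] [c0 c1] [e0 e1]].
have := cabs_le_ReIm _ (z1c w); have := cabs_le_ReIm _ (z2c w).
have := ler_Re_cabs _ (z2c w).
have w0 : 0 < w.1.2 by lra.
rewrite /= (gtr0_norm a0) (gtr0_norm b0) (gtr0_norm w0) (gtr0_norm e0).
move=> ? ? ?; split; [lra|lra|]. lra.
Qed.

Lemma box_Hartogs t w : 0 < t -> t <= 1 -> box t w -> @Hartogs R w.
Proof.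
move=> t0 t1 /(box_cabs _ _ t0)[? ? ?]; apply/andP; split; lra.
Qed.

(** The difference is i Im z2 / Re z2, of modulus below (t/80) / (t/2) = 1/40. *)
Lemma box_near1 t w : 0 < t -> box t w ->
  cabs (z2c w / ((w.1.2)%:C)%C - 1) <= 1/20.
Proof.
move=> t0 /boxP[_ _ [c0 c1] [e0 e1]].
have w0 : 0 < w.1.2 by lra.
have wC : ((w.1.2)%:C)%C != 0 by rewrite eq_complex /= eqxx andbT gt_eqF.
have -> : z2c w / ((w.1.2)%:C)%C - 1 = (Complex 0 w.2) / ((w.1.2)%:C)%C.
  apply: (mulIf wC); rewrite mulrBl !divfK// mul1r.
  by apply/eqP; rewrite eq_complex /= subrr subr0 !eqxx.
rewrite cabsM cabsV cabs_real (gtr0_norm w0) ler_pdivrMr//.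
by rewrite /cabs /= expr0n add0r sqrtr_sqr gtr0_norm//; lra.
Qed.

Lemma leb4_box t : 0 < t -> @leb4 R (box t) = (t / 4 * (t / 80) ^+ 3)%:E.
Proof.
move=> t0; have lebE (a b : R) : a < b -> @lebR R `]a, b[ = (b - a)%:E.
  by move=> ab; have := lebesgue_measure_itv `]a, b[%O; rewrite /= lte_fin ab -EFinB.
have m0 (a b : R) : measurable (`]a, b[ : set (measurableTypeR R)) by [].
have m2 := measurableX (m0 0 (t / 80)) (m0 0 (t / 80)).
have m3 := measurableX m2 (m0 (t / 2) (t * (3/4))).
have t80 : 0 < t / 80 by lra.
have t24 : t / 2 < t * (3/4) by lra.
have E2 := product_measure1_fin _ _ _ _ _ _ (m0 _ _) (m0 _ _) (lebE _ _ t80) (lebE _ _ t80).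
have E3 := product_measure1_fin _ _ _ _ _ _ m2 (m0 _ _) E2 (lebE _ _ t24).
have E4 := product_measure1_fin _ _ _ _ _ _ m3 (m0 _ _) E3 (lebE _ _ t80).
by apply: (etrans E4); congr EFin; field.
Qed.

End Box.

(** * Lower and upper bounds for the kernel on the boxes *)

Section Kernel.
Variable R : realType.
Implicit Types (t : R) (z w : C2 R).

Lemma cabsN (x : R[i]) : cabs (- x) = cabs x.
Proof. exact: normcN. Qed.

Lemma near1_conj (e : R) (x : R[i]) :
  cabs (x - 1) <= e -> cabs (x^*%C - 1) <= e.
Proof.
rewrite -(cabs_conj _ (x - 1)) (_ : (x - 1)^*%C = x^*%C - 1)//.
by case: x => a b; apply/eqP; rewrite eq_complex /= oppr0 !addr0 !eqxx.
Qed.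

Lemma near1_sub (e : R) (x : R[i]) : cabs x <= e -> cabs ((1 - x) - 1) <= e.
Proof. by rewrite addrAC subrr add0r cabsN. Qed.

Lemma near1X2 (e : R) (x : R[i]) :
  cabs (x - 1) <= e -> cabs (x ^+ 2 - 1) <= (1 + e) ^+ 2 - 1.
Proof. by move=> xe; rewrite !expr2; exact: near1M. Qed.

(** With x = Re z2 and y = Re w2, the kernel is 1/(pi^2 x y) times 1/G, where G is near 1. Then
    Re(1/G) >= 1/3, and x y <= t. *)
Lemma Re_KH_ge t z w : 0 < t -> t <= 1 -> box _ (1/64) z -> box _ t w ->
  (3 * pi ^+ 2)^-1 / t <= complex.Re (KH z w).
Proof.
move=> t0 t1 zU wB; have u0 : 0 < 1/64 :> R by lra.
have pi0 := pi_gt0 R; have pi2 : 0 < pi ^+ 2 :> R by rewrite exprn_gt0.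
have [z1z2 z2_gt z2_lt] := box_cabs _ _ _ u0 zU.
have [w1w2 w2_gt w2_lt] := box_cabs _ _ _ t0 wB.
have /near1_conj nw := box_near1 _ _ _ t0 wB.
have nz := box_near1 _ _ _ u0 zU.
have [_ _ [x0 x1] _] := boxP _ _ _ zU; have [_ _ [y0 y1] _] := boxP _ _ _ wB.
set x := z.1.2 in nz x0 x1; set y := w.1.2 in nw y0 y1.
have x_gt0 : 0 < x by lra.
have y_gt0 : 0 < y by lra.
pose u := z1c z * (z1c w)^*%C / (z2c z * (z2c w)^*%C).
pose v := z2c z * (z2c w)^*%C.
have cu : cabs u <= 1/20.
  rewrite /u cabsM cabsV !cabsM !cabs_conj ler_pdivrMr; last by rewrite mulr_gt0; lra.
  have := cabs_ge0 _ (z1c z); have := cabs_ge0 _ (z1c w); nra.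
(* The size 1/64 of the box of z serves here: |z2| < 1/64 makes v small even when |w2| is of order
   1. *)
have cv : cabs v <= 1/20 by rewrite /v cabsM cabs_conj; nra.
pose G := z2c z / x%:C%C * (z2c w / y%:C%C)^*%C * (1 - u) ^+ 2 * (1 - v) ^+ 2.
have nG : cabs (G - 1) <= 7/20.
  (* Counting squares twice, G has six factors within 1/20 of 1, and (21/20)^6 - 1 < 7/20. *)
  apply: le_trans (near1M _ _ _ _ _ (near1M _ _ _ _ _ (near1M _ _ _ _ _ nz nw)
    (near1X2 _ _ (near1_sub _ _ cu))) (near1X2 _ _ (near1_sub _ _ cv))) _.
  lra.
have xC : x%:C%C != 0 by rewrite eq_complex /= eqxx andbT gt_eqF.
have yC : y%:C%C != 0 by rewrite eq_complex /= eqxx andbT gt_eqF.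
have -> : KH z w = ((pi ^+ 2 * x * y)^-1)%:C%C * G^-1.
  have -> : ((pi ^+ 2 * x * y)^-1)%:C%C =
      ((pi : R)%:C%C ^+ 2 * x%:C%C * y%:C%C)^-1.
    by rewrite fmorphV expr2 !rmorphM.
  rewrite /G -invfM; congr (_^-1).
  have -> : (z2c w / y%:C%C)^*%C = (z2c w)^*%C / y%:C%C.
    rewrite -fmorphV /=; case: (z2c w) => p q; apply/eqP.
    by rewrite eq_complex /=; apply/andP; split; apply/eqP; ring.
  rewrite -/u -/v.
  by field; rewrite xC yC.
have -> (a : R) (g : R[i]) : complex.Re (a%:C%C * g) = a * complex.Re g.
  by case: g => g1 g2 /=; rewrite mul0r subr0.
have := near1_Re_inv _ _ nG; move: (complex.Re G^-1) => g g3.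
have yx : pi ^+ 2 * x * y <= pi ^+ 2 * t.
  by rewrite -mulrA ler_pM2l//; nra.
have h : (pi ^+ 2 * t)^-1 <= (pi ^+ 2 * x * y)^-1.
  by rewrite lef_pV2// posrE ?mulr_gt0.
have i0 : 0 < (pi ^+ 2 * t)^-1 by rewrite invr_gt0 mulr_gt0.
have -> (p s : R) : 0 < p -> 0 < s -> (3 * p)^-1 / s = (p * s)^-1 * (1/3) => //.
  by move=> p0 s0; field; rewrite !gt_eqF.
nra.
Qed.

(** For fixed z the two squared factors stay away from 0: |w1| <= |w2| bounds the first below by
    [a], and |w2| < 1 the second by [b]. The remaining |w2| > t/2 gives the 2/t. This covers every z
    of the triangle, as absolute convergence demands. *)
Lemma cabs_KH_le z : @Hartogs R z -> exists2 M : R, 0 <= M &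
  forall t w, 0 < t -> t <= 1 -> box _ t w -> cabs (KH z w) <= M / t.
Proof.
move=> /andP[z12 z21].
have z2_gt0 : 0 < cabs (z2c z) by apply: le_lt_trans z12; exact: cabs_ge0.
pose a := 1 - cabs (z1c z) / cabs (z2c z); pose b := 1 - cabs (z2c z).
have a_gt0 : 0 < a by rewrite subr_gt0 ltr_pdivrMr// mul1r.
have b_gt0 : 0 < b by rewrite subr_gt0.
have pi0 := pi_gt0 R.
exists (2 / (pi ^+ 2 * cabs (z2c z) * a ^+ 2 * b ^+ 2)).
  by rewrite divr_ge0// !mulr_ge0 ?exprn_ge0// ltW.
move=> t w t0 t1 wB.
have [w1w2 w2_gt w2_lt] := box_cabs _ _ _ t0 wB.
have w2_gt0 : 0 < cabs (z2c w) by lra.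
have le1B (x : R[i]) (r : R) : cabs x <= r -> 1 - r <= cabs (1 - x).
  by move=> xr; have := ler_cabsB _ 1 x; rewrite cabs1; lra.
have au : a <= cabs (1 - z1c z * (z1c w)^*%C / (z2c z * (z2c w)^*%C)).
  apply: le1B; rewrite cabsM cabsV !cabsM !cabs_conj invfM mulrACA.
  rewrite ler_piMr ?divr_ge0 ?cabs_ge0//.
  by rewrite ler_pdivrMr// mul1r; lra.
have bv : b <= cabs (1 - z2c z * (z2c w)^*%C).
  by apply: le1B; rewrite cabsM cabs_conj; nra.
rewrite /KH cabsV !(cabsX, cabsM) cabs_real (gtr0_norm pi0) cabs_conj.
have p0 : 0 < pi ^+ 2 * cabs (z2c z) by rewrite mulr_gt0// exprn_gt0.
have -> (p : R) : 0 < p ->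
    2 / (p * a ^+ 2 * b ^+ 2) / t = (p * (t / 2) * a ^+ 2 * b ^+ 2)^-1 => //.
  by move=> p_gt0; field; rewrite !gt_eqF.
have t2 : 0 < t / 2 by lra.
rewrite lef_pV2 ?posrE ?mulr_gt0// ?exprn_gt0//; try by [lra|exact: lt_le_trans au|exact: lt_le_trans bv].
apply: ler_pM; rewrite ?mulr_ge0 ?exprn_ge0//; try exact: ltW.
  apply: ler_pM; rewrite ?mulr_ge0 ?exprn_ge0//; try exact: ltW.
    by rewrite ler_pM2l// ltW.
  by apply: lerXn2r => //; rewrite nnegrE ?cabs_ge0// ltW.
by apply: lerXn2r => //; rewrite nnegrE ?cabs_ge0// ltW.
Qed.

End Kernel.

(** * Step functions over disjoint sets *)

(** At most one term is nonzero at x; [g 0 = 0] handles the vanishing terms and the points outside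
    every [B k]. *)
Lemma apply_sum_indic {T : Type} {R : realType} (B : nat -> set T)
    (g : R -> R) (c : nat -> R) n x :
  trivIset setT B -> g 0 = 0 ->
  g (\sum_(k < n) c k * \1_(B k) x) = \sum_(k < n) g (c k) * \1_(B k) x.
Proof.
move=> tB g0; have [[k Bkx]|nB] := pselect (exists k : 'I_n, B k x); last first.
  rewrite !big1// => k _; rewrite indicE memNset ?mulr0// => Bkx; apply: nB; by exists k.
have jk0 j : j != k -> \1_(B j) x = 0 :> R.
  move=> jk; rewrite indicE memNset// => Bjx; move/eqP: jk; apply.
  by apply/val_inj/(tB j k) => //; exists x.
have k1 : \1_(B k) x = 1 :> R by rewrite indicE mem_set.
rewrite (bigD1 k)//= [in RHS](bigD1 k)//= k1 !mulr1.
rewrite !big1 ?addr0// => j /jk0 ->; by rewrite mulr0.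
Qed.

Lemma integral_sum_indic {d : measure_display} {T : measurableType d}
    {R : realType} (mu : {measure set T -> \bar R}) (D : set T)
    (B : nat -> set T) (c m : nat -> R) n :
  measurable D -> (forall k, measurable (B k)) -> (forall k, B k `<=` D) ->
  (forall k, mu (B k) = (m k)%:E) -> (forall k, 0 <= c k) ->
  (\int[mu]_(x in D) (\sum_(k < n) c k * \1_(B k) x)%:E)%E =
    (\sum_(k < n) c k * m k)%:E.
Proof.
move=> mD mB BD muB c0.
under eq_integral do rewrite -sumEFin.
have mi k : measurable_fun D (\1_(B k) : T -> R) by exact: measurable_indic.
rewrite ge0_integral_sum//; last 2 first.
- move=> k; apply/measurable_EFinP; apply: measurable_funM => //.
- by move=> k x _; rewrite lee_fin mulr_ge0// indicE.
rewrite -sumEFin; apply: eq_bigr => k _.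
under eq_integral do rewrite EFinM.
rewrite ge0_integralZl_EFin//; last exact/measurable_EFinP.
by rewrite integral_indic// (setIidl (BD k)) muB -EFinM.
Qed.

(** * The dyadic shells and the test function *)

Section TestFunction.
Variable R : realType.
Implicit Types (z w : C2 R) (n k : nat).

Definition shell k : set (C2 R) := box R (2^-1 ^+ k).

Lemma radius_gt0 k : 0 < 2^-1 ^+ k :> R.
Proof. by apply: exprn_gt0; lra. Qed.

Lemma radius_le1 k : 2^-1 ^+ k <= 1 :> R.
Proof. by apply: exprn_ile1; lra. Qed.

(** The ranges of Re z2 are disjoint: for j < k, (3/4) 2^-k <= (3/8) 2^-j < 2^-j / 2. *)
Lemma trivIset_shell : trivIset setT shell.
Proof.
have lt_disj j k w : (j < k)%N -> shell j w -> shell k w -> False.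
  move=> jk /boxP[_ _ [w_gt _] _] /boxP[_ _ [_ w_lt] _].
  have : 2^-1 ^+ k <= 2^-1 ^+ j.+1 :> R by apply: ler_wiXn2l => //; lra.
  have := radius_gt0 k; rewrite exprS; lra.
move=> j k _ _ [w [wj wk]]; case: (ltngtP j k) => // jk.
  by case: (lt_disj _ _ _ jk wj wk).
by case: (lt_disj _ _ _ jk wk wj).
Qed.

(** Height t^-p on the shell of size t. The case p = 3 is the test function f; p = 4 is both f^(4/3)
    and the size of f times a kernel of order 1/t. *)
Definition step_fun (p n : nat) w : R :=
  \sum_(k < n) (2^-1 ^+ k) ^- p * \1_(shell k) w.

Lemma step_fun_ge0 p n w : 0 <= step_fun p n w.
Proof.
by apply: sumr_ge0 => k _; rewrite mulr_ge0 ?indicE// invr_ge0 exprn_ge0.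
Qed.

Lemma measurable_step_fun p n : measurable_fun setT (step_fun p n).
Proof.
apply: measurable_sum => k; apply: measurable_funM => //.
by apply: measurable_indic; exact: measurable_box.
Qed.

(** The shells being disjoint, the power acts on each height: (t^-3)^(4/3) = t^-4. *)
Lemma step_fun_powR n w : step_fun 3 n w `^ (4/3) = step_fun 4 n w.
Proof.
have g0 : 0 `^ (4/3) = 0 :> R by rewrite powR0//; lra.
apply: (etrans (apply_sum_indic _ (fun x => x `^ (4/3))
  (fun k => (2^-1 ^+ k) ^- 3) n w trivIset_shell g0)).
apply: eq_bigr => k _; congr (_ * _).
have t0 := ltW (radius_gt0 k).
rewrite -[X in X `^ _]powR_invn// -powRrM.
by rewrite -powR_invn//; congr (_ `^ _); field.
Qed.

Lemma shell_Hartogs k : shell k `<=` @Hartogs R.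
Proof. by move=> w; apply: box_Hartogs; [exact: radius_gt0|exact: radius_le1]. Qed.

(** The volume of B(t) divided by t^4. *)
Definition box_ratio : R := (4 * 80 ^+ 3)^-1.

Lemma box_ratio_gt0 : 0 < box_ratio.
Proof. by rewrite invr_gt0 mulr_gt0// exprn_gt0. Qed.

(** The height t^-4 cancels the volume scaling, so every shell contributes the same amount. *)
Lemma integral_step_fun4 n :
  (\int[@leb4 R]_(w in @Hartogs R) (step_fun 4 n w)%:E)%E = (n%:R * box_ratio)%:E.
Proof.
have mshell k : measurable (shell k) by exact: measurable_box.
have int := integral_sum_indic (@leb4 R) _ shell (fun k => (2^-1 ^+ k) ^- 4)
  (fun k => 2^-1 ^+ k / 4 * (2^-1 ^+ k / 80) ^+ 3) n
  (measurable_Hartogs R) mshell shell_Hartogs.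
rewrite /step_fun int; last 2 first.
- by move=> k; apply: leb4_box; exact: radius_gt0.
- by move=> k; rewrite invr_ge0 exprn_ge0.
congr EFin; rewrite (eq_bigr (fun=> box_ratio)); last first.
  move=> k _; rewrite /box_ratio; have := radius_gt0 k.
  by move: (2^-1 ^+ k) => t t0; field; rewrite gt_eqF.
by rewrite sumr_const card_ord mulr_natl.
Qed.

Lemma integrable_step_fun4 n :
  (@leb4 R).-integrable (@Hartogs R) (fun w => (step_fun 4 n w)%:E).
Proof.
apply/integrableP; split.
  by apply/measurable_EFinP; apply: measurable_funTS; exact: measurable_step_fun.
under eq_integral do rewrite gee0_abs ?lee_fin ?step_fun_ge0//.
by rewrite integral_step_fun4 ltry.
Qed.

(** On each shell t^-1 t^-3 = t^-4. The sign of c is free, so upper bounds follow by negation. *)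
Lemma step_fun34_le n w (g : C2 R -> R) (c : R) :
  (forall t, 0 < t -> t <= 1 -> box R t w -> c / t <= g w) ->
  c * step_fun 4 n w <= g w * step_fun 3 n w.
Proof.
move=> cg; rewrite !mulr_sumr; apply: ler_sum => k _.
rewrite indicE; case: (boolP (w \in shell k)) => [/set_mem wk|_]; last by rewrite !mulr0.
rewrite !mulr1 exprSr invfM mulrCA mulrC ler_wpM2r//.
by apply: cg wk; [exact: radius_gt0|exact: radius_le1].
Qed.

End TestFunction.

(** * Absolute convergence and growth of the projection of the test function *)

Section Projection.
Variable R : realType.
Implicit Types (z w : C2 R) (n : nat).

Definition testf n w : R[i] := (step_fun R 3 n w)%:C%C.

Lemma cmeasurable_testf n : cmeasurable (testf n).
Proof. by split; [exact: measurable_step_fun|exact: measurable_cst]. Qed.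

Lemma cabs_testf n w : cabs (testf n w) = step_fun R 3 n w.
Proof. by rewrite cabs_real ger0_norm// step_fun_ge0. Qed.

Lemma cmeasurable_KH_testf n z : cmeasurable (fun w => KH z w * testf n w).
Proof.
apply: (cmeasurableM _ _ _ (cmeasurable_testf n)).
exact: (cmeasurable_comp _ _ (pair1_measurable z) (cmeasurable_KH R)).
Qed.

(** Dominated by the integrable function M [step_fun] 4, with M depending on z. *)
Lemma integrable_KH_testf n z : @Hartogs R z ->
  (@leb4 R).-integrable (@Hartogs R) (fun w => (cabs (KH z w * testf n w))%:E).
Proof.
move=> Hz; have [M M0 KM] := cabs_KH_le _ _ Hz.
apply: (le_integrable (measurable_Hartogs R) _ _
  (integrableZl (measurable_Hartogs R) M (integrable_step_fun4 R n))).
  apply/measurable_EFinP; apply: measurable_funTS.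
  exact: measurable_cabs (cmeasurable_KH_testf n z).
move=> w _; rewrite -EFinM !abse_EFin lee_fin.
rewrite !ger0_norm ?cabs_ge0 ?mulr_ge0 ?step_fun_ge0//.
(* Negating turns |K| <= M/t into the lower bound -M/t <= -|K|. *)
rewrite cabsM cabs_testf -lerN2 -!mulNr.
apply: (step_fun34_le _ _ _ (fun w => - cabs (KH z w))) => t t0 t1 wB.
by rewrite mulNr lerN2; exact: KM.
Qed.

(** |P f| >= Re P f, and the real part of the integrand is at least c [step_fun] 4, so the equal
    contributions of the n shells add up without cancellation. *)
Lemma cabs_bergmanP_testf_ge n z : box R (1/64) z ->
  (3 * pi ^+ 2)^-1 * (n%:R * box_ratio R) <= cabs (bergmanP (testf n) z).
Proof.
move=> zU; set c := (3 * pi ^+ 2)^-1.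
have Hz : @Hartogs R z by apply: box_Hartogs zU; lra.
have mH := measurable_Hartogs R.
apply: le_trans (le_trans (ler_norm _) (ler_Re_cabs _ _)).
rewrite -[complex.Re (bergmanP _ _)]/(Rintegral (@leb4 R) (@Hartogs R)
  (fun w => complex.Re (KH z w * testf n w))).
have <- : Rintegral (@leb4 R) (@Hartogs R) (fun w => c * step_fun R 4 n w)
    = c * (n%:R * box_ratio R).
  rewrite RintegralZl//; last exact: integrable_step_fun4.
  by rewrite /Rintegral integral_step_fun4.
apply: le_Rintegral => //.
- exact: (integrableZl mH c (integrable_step_fun4 R n)).
- apply: (le_integrable mH _ _ (integrable_KH_testf n z Hz)).
    apply/measurable_EFinP; apply: measurable_funTS.
    exact: (cmeasurable_KH_testf n z).1.
  by move=> w _; rewrite !abse_EFin lee_fin (ger0_norm (cabs_ge0 _ _)) ler_Re_cabs.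
move=> w _.
have -> : complex.Re (KH z w * testf n w) = complex.Re (KH z w) * step_fun R 3 n w.
  by rewrite /testf; case: (KH z w) => a b /=; rewrite mulr0 subr0.
apply: (step_fun34_le _ _ _ (fun w => complex.Re (KH z w))) => t t0 t1 wB.
exact: Re_KH_ge.
Qed.

End Projection.

(** * Failure of the weak-type inequality as the number of shells grows *)

Theorem theorem4p1 (R : realType) :
  ~ (exists C : R, 0 < C /\
       forall f : C2 R -> R[i],
         (* f is measurable on H *)
         measurable_fun (@Hartogs R) (fun w => complex.Re (f w)) ->
         measurable_fun (@Hartogs R) (fun w => complex.Im (f w)) ->
         (* f is in L^{4/3}(H) *)
         (\int[@leb4 R]_(w in @Hartogs R) ((cabs (f w)) `^ (4/3 : R))%:E < +oo)%E ->
         (* the integral defining P(f)(z) converges absolutely for every z in H *)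
         (forall z, @Hartogs R z ->
            (@leb4 R).-integrable (@Hartogs R) (fun w => (cabs (KH z w * f w))%:E)) ->
         forall lambda : R, 0 < lambda ->
           (@leb4 R [set z | @Hartogs R z /\ (lambda < cabs (bergmanP f z))%R]
            <= ((C * fine (\int[@leb4 R]_(w in @Hartogs R) ((cabs (f w)) `^ (4/3 : R))%:E)
                / lambda `^ (4/3 : R))%R)%:E)%E).
Proof.
move=> [C [C0 weak]].
have mH := measurable_Hartogs R.
have r0 := box_ratio_gt0 R; set r := box_ratio R in r0.
have pi0 := pi_gt0 R.
(* Half the constant in the lower bound for |P f|, so that |P f| > b n holds strictly on U. *)
pose b := (3 * pi ^+ 2)^-1 * r / 2.
have b0 : 0 < b by rewrite divr_gt0// mulr_gt0// invr_gt0 mulr_gt0// exprn_gt0.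
pose U := box R (1/64).
have u0 : 0 < 1/64 :> R by lra.
pose muU : R := 1/64 / 4 * (1/64 / 80) ^+ 3.
have muU0 : 0 < muU by rewrite mulr_gt0 ?exprn_gt0//; lra.
have bound (m : nat) : (0 < m)%N -> muU * b `^ (4/3) * m%:R <= C * r.
  move=> m0; have m_gt0 : 0 < m%:R :> R by rewrite ltr0n.
  (* A cube, so that n^(4/3) = m^4 is an integer power; dividing muU b^(4/3) m^4 <= C m^3 r by m^3
     leaves a bound linear in m. *)
  pose n := (m ^ 3)%N; pose lambda : R := b * n%:R.
  have n_gt0 : 0 < n%:R :> R by rewrite ltr0n expn_gt0 m0.
  have l0 : 0 < lambda by rewrite mulr_gt0.
  have normf : (\int[@leb4 R]_(w in @Hartogs R) (cabs (testf R n w) `^ (4/3))%:E)%E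
      = (n%:R * r)%:E.
    rewrite -integral_step_fun4; apply: eq_integral => w _.
    by rewrite cabs_testf step_fun_powR.
  have [mr mi] := cmeasurable_testf R n.
  have := weak (testf R n) (measurable_funTS mr) (measurable_funTS mi).
  rewrite normf ltry => /(_ isT (integrable_KH_testf R n) _ l0) leC.
  have {leC} : (muU%:E <= (C * (n%:R * r) / lambda `^ (4/3))%:E)%E.
    apply: le_trans leC; rewrite -(leb4_box _ _ u0).
    apply: le_measure; rewrite ?inE.
    - exact: measurable_box.
    - have mP : measurable_fun setT (fun z => cabs (bergmanP (testf R n) z)).
        exact: measurable_bergmanP (cmeasurable_testf R n).
      rewrite (_ : [set z | _] = @Hartogs R `&`
          (fun z => lambda < cabs (bergmanP (testf R n) z)) @^-1` [set true]).
        apply: measurableI => //; rewrite -[X in measurable X]setTI.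
        exact: (measurable_fun_ltr (measurable_cst lambda) mP).
      by apply/seteqP; split => z [].
    - move=> z zU; split; first by apply: box_Hartogs zU; lra.
      apply: lt_le_trans (cabs_bergmanP_testf_ge _ n _ zU).
      by rewrite /lambda /b -/r; move: (mulr_gt0 b0 n_gt0); rewrite /b; lra.
  rewrite lee_fin ler_pdivlMr ?powR_gt0//.
  have -> : lambda `^ (4/3) = b `^ (4/3) * m%:R ^+ 4.
    rewrite /lambda powRM ?ltW// /n natrX; congr (_ * _).
    rewrite -[X in X `^ _]powR_mulrn ?ltW// -powRrM -powR_mulrn ?ltW//.
    by congr (_ `^ _); field.
  rewrite /n natrX => le4.
  by rewrite -(ler_pM2r (exprn_gt0 3 m_gt0)); move: le4; congr (_ <= _); ring.
have D0 : 0 < muU * b `^ (4/3) by rewrite mulr_gt0// powR_gt0.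
(* The Archimedean bound exceeds the largest m that [bound] allows; the successor also makes m
   positive. *)
pose m := (Num.bound (C * r / (muU * b `^ (4/3)))).+1.
have := bound m isT; rewrite -ler_pdivlMl// leNgt => /negP; apply.
rewrite mulrC.
have Cr0 : 0 <= C * r / (muU * b `^ (4/3)) by rewrite divr_ge0 ?mulr_ge0 ?powR_ge0// ltW.
apply: lt_trans (archi_boundP Cr0) _.
by rewrite ltr_nat.
Qed.
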